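(* Let $m,n\ge1$ be integers and let $\mathbf{p}(\mathbf{s})=\sum_{|\mathbf{i}|=n}\mathbf{c}_{\mathbf{i}}B^n_{\mathbf{i}}(\mathbf{s})$ be a triangular Bézier surface of degree $n$ in $\mathbb{R}^3$, expressed in barycentric coordinates with respect to a fixed non-degenerate tetrahedron $\Lambda$. Let $\mathbf{M}=(m_{\mathbf{i},\mathbf{j}})_{|\mathbf{i}|=m,|\mathbf{j}|=m}$ be the $\binom{m+3}{3}\times\binom{m+3}{3}$ matrix of weak approximate implicitization, $$m_{\mathbf{i},\mathbf{j}}=\int_\Omega B^m_{\mathbf{i}}(\mathbf{p}(\mathbf{s}))\,B^m_{\mathbf{j}}(\mathbf{p}(\mathbf{s}))\,\mathrm{d}\mathbf{s},$$ so that $\int_\Omega (q(\mathbf{p}(\mathbf{s})))^2\,\mathrm{d}\mathbf{s}=\mathbf{b}^T\mathbf{M}\mathbf{b}$ for every $q(\mathbf{u})=\sum_{|\mathbf{i}|=m}b_{\mathbf{i}}B^m_{\mathbf{i}}(\mathbf{u})$. Then $$\mathbf{M}=\mathbf{D}^T\mathbf{A}\mathbf{D},$$ where $\mathbf{D}$ is the matrix with rows indexed by $|\mathbf{j}|=mn$ and columns indexed by $|\mathbf{i}|=m$ whose $(\mathbf{j},\mathbf{i})$ entry $d_{\mathbf{i},\mathbf{j}}$ is determined by $B^m_{\mathbf{i}}(\mathbf{p}(\mathbf{s}))=\sum_{|\mathbf{j}|=mn}d_{\mathbf{i},\mathbf{j}}B^{mn}_{\mathbf{j}}(\mathbf{s})$,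 and $\mathbf{A}=(a_{\mathbf{i},\mathbf{j}})_{|\mathbf{i}|=mn,|\mathbf{j}|=mn}$ is the symmetric matrix $$a_{\mathbf{i},\mathbf{j}}=\int_\Omega B^{mn}_{\mathbf{i}}(\mathbf{s})B^{mn}_{\mathbf{j}}(\mathbf{s})\,\mathrm{d}\mathbf{s}=\frac{\binom{mn}{\mathbf{i}}\binom{mn}{\mathbf{j}}}{\binom{2mn}{\mathbf{i}+\mathbf{j}}}\,\frac{1}{(2mn+1)(2mn+2)},$$ which depends only on $m$ and $n$ (and not on the surface $\mathbf{p}$).
   Context: Barycentric coordinates. A point $\mathbf{x}\in\mathbb{R}^l$ has barycentric coordinates $\bm{\beta}=(\beta_1,\dots,\beta_{l+1})$ with respect to a non-degenerate simplex with vertices $\mathbf{a}_1,\dots,\mathbf{a}_{l+1}$ if $\mathbf{x}=\sum_i\beta_i\mathbf{a}_i$ and $\sum_i\beta_i=1$. Points of the triangle $\Omega$ are written $\mathbf{s}=(s_1,s_2,s_3)$, $s_k\ge0$, $s_1+s_2+s_3=1$; points of $\mathbb{R}^3$ are written $\mathbf{u}=(u_1,u_2,u_3,u_4)$ in barycentric coordinates with respect to the tetrahedron $\Lambda$. Integration. $\int_\Omega f(\mathbf{s})\,\mathrm{d}\mathbf{s}$ means $\int_{\{s_1,s_2\ge0,\ s_1+s_2\le1\}}f(s_1,s_2,1-s_1-s_2)\,\mathrm{d}s_1\,\mathrm{d}s_2$ (so $\int_\Omega 1\,\mathrm{d}\mathbf{s}=\tfrac12$ and $\int_\Omega B^N_{\mathbf{i}}(\mathbf{s})\,\mathrm{d}\mathbf{s}=\frac{1}{(N+1)(N+2)}$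 for all $|\mathbf{i}|=N$). Multi-indices and Bernstein polynomials. Multi-indices have non-negative integer entries (three entries for polynomials in $\mathbf{s}$, four for polynomials in $\mathbf{u}$); $|\mathbf{i}|$ is the sum of the entries, $\bm{\beta}^{\mathbf{i}}=\prod_k\beta_k^{i_k}$, $\binom{n}{\mathbf{i}}=\frac{n!}{\prod_k i_k!}$ for $|\mathbf{i}|=n$, and $B^n_{\mathbf{i}}(\bm{\beta})=\binom{n}{\mathbf{i}}\bm{\beta}^{\mathbf{i}}$. Multi-indices are ordered lexicographically to index rows and columns of matrices, and $\mathbf{b}=(b_{\mathbf{i}})_{|\mathbf{i}|=m}$ is a column vector. Bézier triangle. The control points $\mathbf{c}_{\mathbf{i}}$ are points of $\mathbb{R}^3$, given by their barycentric coordinates with respect to $\Lambda$; thus $\mathbf{p}(\mathbf{s})=(p_1(\mathbf{s}),\dots,p_4(\mathbf{s}))$ with $\sum_k p_k(\mathbf{s})=1$, and $B^m_{\mathbf{i}}(\mathbf{p}(\mathbf{s}))=\binom{m}{\mathbf{i}}\prod_{k=1}^4p_k(\mathbf{s})^{i_k}$, a polynomial of degree $mn$ that has a unique expansion in the degree-$mn$ triangular Bernstein basis $(B^{mn}_{\mathbf{j}})_{|\mathbf{j}|=mn}$. *)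

(* Defs.v *)
From HB Require Import structures.
From mathcomp Require Import all_boot all_order all_algebra.
From mathcomp Require Import all_classical all_reals all_analysis.

Set Implicit Arguments.
Unset Strict Implicit.
Unset Printing Implicit Defensive.

Import Order.TTheory GRing.Theory Num.Theory.
Import numFieldNormedType.Exports.
Local Open Scope classical_set_scope.
Local Open Scope ring_scope.

(* The k-entry multi-indices t with |t| = d, in increasing lexicographic order;
   see mem_mindices, size_mindices and mindices_sorted below. *)
Fixpoint mindices (k d : nat) : seq (k.-tuple nat) :=
  if k is k'.+1 then
    flatten [seq [seq cons_tuple i t | t <- mindices k' (d - i)]
            | i <- iota 0 d.+1]
  else if d == 0%N then [:: [tuple]] else [::].

Lemma mindicesS (k d : nat) :
  mindices k.+1 d =
  flatten [seq [seq cons_tuple i t | t <- mindices k (d - i)]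
          | i <- iota 0 d.+1].
Proof. by []. Qed.

Lemma mem_mindices (k d : nat) (t : k.-tuple nat) :
  (t \in mindices k d) = (\sum_(l < k) tnth t l == d)%N.
Proof.
elim: k d t => [|k IH] d t.
  rewrite big_ord0 tuple0 /= eq_sym; case: d => [|d] //=.
case/tupleP: t => x t; rewrite big_ord_recl tnth0.
under eq_bigr => l _ do rewrite tnthS.
apply/flatten_mapP/eqP => /=.
  case=> i; rewrite -[0%N :: iota 1 d]/(iota 0 d.+1) mem_iota add0n ltnS /=.
  move=> id /mapP[u]; rewrite IH => /eqP su /(congr1 val)[-> /val_inj ->].
  by rewrite su subnKC.
move=> sd; exists x.
  by rewrite -[0%N :: iota 1 d]/(iota 0 d.+1) mem_iota /= add0n ltnS -sd leq_addr.
by apply/mapP; exists t => //; rewrite IH -sd addKn.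
Qed.

Lemma size_mindices (k d : nat) : size (mindices k.+1 d) = 'C(d + k, k).
Proof.
have step (k' d' : nat) :
    size (mindices k'.+1 d') = (\sum_(0 <= i < d'.+1) size (mindices k' i))%N.
  rewrite mindicesS size_flatten /shape -map_comp sumnE big_map.
  under eq_bigr => i _ do rewrite /comp size_map.
  rewrite -/(index_iota 0 d'.+1) big_nat_rev /=.
  by apply: eq_big_nat => i /andP[_ id]; rewrite add0n subSS subKn.
elim: k d => [|k IH] d; rewrite step.
  by rewrite bin0 big_nat_recl //= big1.
under eq_bigr => i _ do rewrite IH.
elim: d => [|d IHd]; first by rewrite big_nat1 !add0n !binn.
by rewrite big_nat_recr //= IHd [in RHS]addSn binS addSnnS.
Qed.

Lemma mindices_sorted (k d : nat) :
  pairwise (fun t u => (tval t : seqlexi nat) < (tval u : seqlexi nat))%O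
    (mindices k d).
Proof.
elim: k d => [|k IH] d; first by rewrite /=; case: ifP.
rewrite mindicesS.
elim: d.+1 (0)%N => //= N IHN i0.
rewrite pairwise_cat IHN andbT; apply/andP; split.
  apply/allrelP => _ v /mapP[t _ ->] /flatten_mapP[j].
  rewrite mem_iota => /andP[ij _] /mapP[u _ ->] /=.
  by rewrite Order.SeqLexiOrder.ltxi_cons leEnat ltnW //= leqNgt ij.
rewrite pairwise_map; apply: sub_pairwise (IH (d - i0)%N) => t u /=.
by rewrite Order.SeqLexiOrder.ltxi_cons lexx.
Qed.

Definition mindex (k d : nat) (i : 'I_('C(d + k, k))) : k.+1.-tuple nat :=
  nth [tuple 0%N | _ < k.+1] (mindices k.+1 d) i.
Arguments mindex : clear implicits.

Section Bernstein.
Context {R : realType}.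

Definition multinomial (k d : nat) (i : k.-tuple nat) : R :=
  (d`!)%:R / \prod_(l < k) ((tnth i l)`!)%:R.

Definition addmi (k : nat) (i j : k.-tuple nat) : k.-tuple nat :=
  [tuple (tnth i l + tnth j l)%N | l < k].

Definition bernstein (k d : nat) (i : k.-tuple nat) (b : 'rV[R]_k) : R :=
  multinomial d i * \prod_(l < k) b 0 l ^+ tnth i l.

Definition nondegenerate_simplex (l : nat) (a : 'I_l.+1 -> 'rV[R]_l) : Prop :=
  row_free (\matrix_(i < l) (a (lift ord0 i) - a ord0)).

Definition barycentric_coords (l : nat) (a : 'I_l.+1 -> 'rV[R]_l)
    (x : 'rV[R]_l) (b : 'rV[R]_l.+1) : Prop :=
  x = \sum_(i < l.+1) b 0 i *: a i /\ \sum_(i < l.+1) b 0 i = 1.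

Definition triangle : set 'rV[R]_3 :=
  [set s | (forall k, 0 <= s 0 k) /\ \sum_(k < 3) s 0 k = 1].

Definition triangle_point (s1 s2 : R) : 'rV[R]_3 :=
  \row_(k < 3) [:: s1; s2; 1 - s1 - s2]`_k.

(* The parameter triangle has area 1/2. *)
Definition triangle_integral (f : 'rV[R]_3 -> R) : R :=
  \int[(lebesgue_measure \x lebesgue_measure)%E]_(z in
      [set z : R * R | [/\ 0 <= z.1, 0 <= z.2 & z.1 + z.2 <= 1]])
    f (triangle_point z.1 z.2).

Definition bezier_triangle (n : nat) (c : 'I_('C(n + 2, 2)) -> 'rV[R]_4)
    (s : 'rV[R]_3) : 'rV[R]_4 :=
  \sum_i bernstein n (mindex 2 n i) s *: c i.

Definition bernstein_form (m : nat) (b : 'cV[R]_('C(m + 3, 3)))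
    (u : 'rV[R]_4) : R :=
  \sum_i b i 0 * bernstein m (mindex 3 m i) u.

Definition weak_implicit_mx (m : nat) (p : 'rV[R]_3 -> 'rV[R]_4) :
    'M[R]_('C(m + 3, 3)) :=
  \matrix_(i, j) triangle_integral (fun s =>
    bernstein m (mindex 3 m i) (p s) * bernstein m (mindex 3 m j) (p s)).

(* Column i of D holds the coefficients of the i-th composed polynomial. *)
Definition bernstein_expansion (m N : nat) (p : 'rV[R]_3 -> 'rV[R]_4)
    (D : 'M[R]_('C(N + 2, 2), 'C(m + 3, 3))) : Prop :=
  forall i s, triangle s ->
    bernstein m (mindex 3 m i) (p s) =
    \sum_j D j i * bernstein N (mindex 2 N j) s.

Definition bernstein_gram_mx (N : nat) : 'M[R]_('C(N + 2, 2)) :=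
  \matrix_(i, j) triangle_integral (fun s =>
    bernstein N (mindex 2 N i) s * bernstein N (mindex 2 N j) s).

End Bernstein.

(* Main.v *)
Require Import Defs.
From HB Require Import structures.
From mathcomp Require Import all_boot all_order all_algebra.
From mathcomp Require Import all_classical all_reals all_analysis.
From mathcomp Require Import measurable_realfun ring lra.
Import Order.TTheory GRing.Theory Num.Theory.
Import numFieldNormedType.Exports.
Local Open Scope ring_scope.

(** The integrals of products of composed polynomials reduce to finite linear
    algebra because everything lives in the span of the Bernstein basis of
    degree N = mn.

    Products of Bernstein polynomials are, up to a ratio of multinomial
    coefficients, Bernstein polynomials of the summed degree ([bernsteinM]).
    Hence the spans of the Bernstein bases are closed under products in the
    graded sense, and B^m_i(p(s)), which is a scalar times a product of m
    coordinates of p, each of degree n, expands in degree mn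
    ([bernstein_span_comp]): this is the matrix D. It is unique because the
    monomials of a fixed degree are linearly independent as functions on the
    positive orthant ([monomials_free]), and homogeneity carries this from the
    triangle to the whole orthant ([bernstein_free]).

    The integral of a product of two Bernstein forms with coefficient vectors
    v and w is v^T A w ([triangle_integral_gram]). Applied to two columns of D
    it gives M = D^T A D; applied twice to D b, the coefficient vector of
    q(p(s)), it gives the quadratic form b^T M b.

    The entries of A come from the fact that all Bernstein polynomials of
    degree d have the same integral 1/((d+1)(d+2)), applied to [bernsteinM].
    That is Dirichlet's integral ([integral_dirichlet]): Tonelli's theorem turns
    it into two Beta integrals, each evaluated through a polynomial
    antiderivative. The integrands being nonnegative, the same computation shows
    that they are integrable, which justifies every use of linearity. *)

Set Implicit Arguments.
Unset Strict Implicit.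
Unset Printing Implicit Defensive.

(** * Beta integrals *)

Section BetaIntegral.
Context {R : realType}.

Lemma factr_neq0 (n : nat) : n`!%:R != 0 :> R.
Proof. by rewrite pnatr_eq0 -lt0n fact_gt0. Qed.

(** Integration by parts at the level of polynomials: an antiderivative of
    'X^b.+1 * (h - 'X)^c corrects the product 'X^b.+1 * (h - 'X)^c.+1 into one
    of 'X^b * (h - 'X)^c.+1, and that product vanishes at both ends 0 and h. *)
Lemma beta_antiderivative (h : R) (b c : nat) :
  exists2 F : {poly R}, F^`() = 'X^b * (h%:P - 'X) ^+ c
    & F.[h] - F.[0] = b`!%:R * c`!%:R / (b + c).+1`!%:R * h ^+ (b + c).+1.
Proof.
elim: c b => [|c IH] b.
  have nz : b.+1%:R != 0 :> R by rewrite pnatr_eq0.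
  exists (b.+1%:R^-1 *: 'X^(b.+1)).
    by rewrite derivZ derivXn /= -(scaler_nat b.+1 'X^b) scalerA mulVf//
      scale1r expr0 mulr1.
  rewrite !hornerE/= expr0n/= mulr0 subr0.
  have nf := factr_neq0 b.
  rewrite factS natrM; move: nf nz.
  by move: (b`!%:R : R) (b.+1%:R : R) => u v un vn; field; rewrite un vn.
have nz : b.+1%:R != 0 :> R by rewrite pnatr_eq0.
have [G dG vG] := IH b.+1.
exists (b.+1%:R^-1 *: ('X^(b.+1) * (h%:P - 'X) ^+ c.+1)
        + (c.+1%:R / b.+1%:R) *: G).
  rewrite derivD !derivZ derivM dG derivXn deriv_exp derivB derivC derivX.
  have E : (b.+1%:R^-1)%:P * b.+1%:R = 1 :> {poly R}.
    by rewrite -polyC_natr -polyCM mulVf.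
  rewrite /= -!mul_polyC polyCM polyC_natr.
  rewrite -['X^b *+ _]mulr_natr -[_ * _ *+ _]mulr_natr !exprS; move: E.
  move: (_%:P) (b.+1%:R : {poly R}) (_ - _ : {poly R}) => u v w E.
  by ring: E.
rewrite !hornerE/= subrr !expr0n/= ?mul0r ?mulr0 ?mul0r ?subr0 ?add0r.
rewrite -mulrBr vG addSn addnS.
have := factr_neq0 (b + c).+2; rewrite [b.+1`!]factS [c.+1`!]factS.
rewrite (natrM _ b.+1) (natrM _ c.+1); move: nz.
move: ((b + c).+2`!%:R : R) (b.+1%:R : R) => u v un vn.
by field; rewrite un vn.
Qed.

Lemma integral_horner (F : {poly R}) (h : R) : 0 <= h ->
  (\int[lebesgue_measure]_(x in `[0%R, h]%classic) (F^`().[x])%:E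
   = (F.[h] - F.[0])%:E)%E.
Proof.
rewrite le_eqVlt => /predU1P[<-|h0].
  by rewrite set_itv1 integral_set1 subrr.
rewrite EFinB; apply: continuous_FTC2 => //.
- by apply: continuous_subspaceT => x; exact: continuous_horner.
- split=> [x _||]; first exact: derivable_horner.
  + by apply: cvg_at_right_filter; exact: continuous_horner.
  + by apply: cvg_at_left_filter; exact: continuous_horner.
- by move=> x _; rewrite derivE.
Qed.

Lemma integral_beta (h : R) (b c : nat) : 0 <= h ->
  (\int[lebesgue_measure]_(x in `[0%R, h]%classic) (x ^+ b * (h - x) ^+ c)%:E
   = (b`!%:R * c`!%:R / (b + c).+1`!%:R * h ^+ (b + c).+1)%:E)%E.
Proof.
move=> h0; have [F dF <-] := beta_antiderivative h b c.
rewrite -integral_horner// dF; apply: eq_integral => x _.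
by rewrite hornerM hornerXn horner_exp !hornerE.
Qed.

End BetaIntegral.

(** * Dirichlet's integral *)

Section Triangle.
Context {R : realType}.
Local Notation mu := (@lebesgue_measure R).
Local Notation T :=
  [set z : R * R | [/\ 0 <= z.1, 0 <= z.2 & z.1 + z.2 <= 1]]%classic.

Definition dirichlet_fun (a b c : nat) (z : R * R) : R :=
  z.1 ^+ a * z.2 ^+ b * (1 - z.1 - z.2) ^+ c.

Lemma measurable_parameter_triangle :
  measurable (T : set (measurableTypeR R * measurableTypeR R)).
Proof.
rewrite (_ : T = ([set z : R * R | 0 <= z.1] `&` [set z : R * R| 0 <= z.2]
   `&` [set z : R * R| z.1 + z.2 <= 1])%classic); last first.
  by apply/seteqP; split => z /= => [[]|[[]]].
by do 2 ?apply: measurableI; rewrite -[X in measurable X]setTI;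
  apply: measurable_fun_le => //; exact: measurable_funD.
Qed.

Lemma measurable_dirichlet_fun a b c :
  measurable_fun [set: measurableTypeR R * measurableTypeR R]
    (dirichlet_fun a b c).
Proof.
apply: measurable_funM; first apply: measurable_funM;
  apply: measurable_funX => //.
by do 2 ?apply: measurable_funB.
Qed.

(** The slice of the triangle at x is [0, 1 - x], on which the inner integral
    is a Beta integral with h = 1 - x; its value is a multiple of
    (1 - x)^(b + c + 1), so the outer integral is a Beta integral with h = 1. *)
Lemma integral_dirichlet (a b c : nat) :
  (\int[(mu \x mu)%E]_(z in T) (dirichlet_fun a b c z)%:E =
   (a`!%:R * b`!%:R * c`!%:R / (a + b + c).+2`!%:R)%:E)%E.
Proof.
have mT := measurable_parameter_triangle.
rewrite integral_mkcond fubini_tonelli1; last 2 first.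
- apply/(measurable_restrictT _ mT)/measurable_EFinP.
  by apply: measurable_funS (measurable_dirichlet_fun a b c).
- move=> z; rewrite patchE; case: ifPn => // /set_mem[/= z1 z2 z12].
  by rewrite lee_fin !mulr_ge0// exprn_ge0//; lra.
set C : R := b`!%:R * c`!%:R / (b + c).+1`!%:R.
(* C (1 - x)^(b + c + 1) is the value of the inner integral, without x^a. *)
transitivity (\int[mu]_(x in `[0%R, 1%R]%classic)
   (C%:E * (x ^+ a * (1 - x) ^+ (b + c).+1)%:E))%E.
  rewrite [RHS]integral_mkcond; apply: eq_integral => x _ /=.
  rewrite /fubini_F patchE; case: ifPn => [|x01].
    rewrite inE/= in_itv/= => /andP[x0 x1].
    transitivity (\int[mu]_(y in `[0%R, (1 - x)%R]%classic)
       ((x ^+ a)%:E * (y ^+ b * (1 - x - y) ^+ c)%:E))%E.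
      rewrite [RHS]integral_mkcond; apply: eq_integral => y _ /=.
      rewrite !patchE /dirichlet_fun /=.
      congr (if _ then _ else _); last by rewrite -EFinM mulrA.
      apply/idP/idP; rewrite !inE/= in_itv/=.
        by case=> _ -> ?; lra.
      by case/andP=> -> ?; split => //; lra.
    rewrite ge0_integralZl_EFin//; last 3 first.
    - by move=> y /=; rewrite in_itv/= lee_fin => /andP[y0 y1];
        rewrite mulr_ge0// exprn_ge0//; lra.
    - apply/measurable_EFinP; apply: measurable_funM;
        apply: measurable_funX => //.
      exact: measurable_funB.
    - by rewrite exprn_ge0.
    by rewrite integral_beta ?subr_ge0// -!EFinM; congr EFin; rewrite /C mulrCA.
  rewrite integral0_eq// => y _; rewrite patchE; case: ifPn => //.
  move=> /set_mem[/= ? ? ?].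
  by case/negP: x01; rewrite inE/= in_itv/=; apply/andP; split; lra.
rewrite ge0_integralZl_EFin//; last 3 first.
- by move=> y /=; rewrite in_itv/= lee_fin => /andP[y0 y1];
    rewrite mulr_ge0// exprn_ge0//; lra.
- apply/measurable_EFinP; apply: measurable_funM; apply: measurable_funX => //.
  exact: measurable_funB.
- by rewrite /C !mulr_ge0.
rewrite integral_beta// expr1n mulr1 -EFinM; congr EFin.
rewrite /C !addnS !addnA; have := factr_neq0 (b + c).+1 => nz1.
have := factr_neq0 (a + b + c).+2 => nz2.
by field; rewrite nz1 nz2.
Qed.

End Triangle.

(** * Enumeration of multi-indices *)

Section MultiIndices.

Lemma mindices_uniq (k d : nat) : uniq (mindices k d).
Proof.
by apply: pairwise_uniq (mindices_sorted k d) => t; rewrite ltxx.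
Qed.

Lemma mem_mindex (k d : nat) (i : 'I_('C(d + k, k))) :
  mindex k d i \in mindices k.+1 d.
Proof. by rewrite mem_nth// size_mindices. Qed.

Lemma mindex_inj (k d : nat) : injective (mindex k d).
Proof.
move=> i j /eqP; rewrite nth_uniq ?size_mindices ?mindices_uniq//.
by move=> /eqP/val_inj.
Qed.

Lemma mem_addmi (k d e : nat) (t u : k.-tuple nat) :
  t \in mindices k d -> u \in mindices k e -> addmi t u \in mindices k (d + e).
Proof.
rewrite !mem_mindices => /eqP td /eqP ue; rewrite -td -ue -big_split/=.
by apply/eqP/eq_bigr => l _; rewrite tnth_mktuple.
Qed.

Lemma sum_mindex (V : nmodType) (k d : nat) (F : k.+1.-tuple nat -> V) :
  \sum_i F (mindex k d i) = \sum_(t <- mindices k.+1 d) F t.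
Proof.
rewrite (big_nth [tuple 0%N | _ < k.+1]) size_mindices.
by rewrite (big_mkord xpredT (fun i => F (nth _ _ i))).
Qed.

(** A function of the rank i thus becomes one of the multi-index, namely
    t |-> \sum_(i | mindex k d i == t) v i, with junk value 0 at other t. *)
Lemma sum_mindex_eq (V : nmodType) (k d : nat) (v : 'I_('C(d + k, k)) -> V)
    (j : 'I_('C(d + k, k))) :
  \sum_(i | mindex k d i == mindex k d j) v i = v j.
Proof.
by under eq_bigl do rewrite (inj_eq (@mindex_inj k d)); rewrite big_pred1_eq.
Qed.

End MultiIndices.

(** * Algebra of Bernstein polynomials *)

Section BernsteinAlgebra.
Context {R : realType}.

Lemma multinomial_neq0 (k d : nat) (t : k.-tuple nat) :
  multinomial d t != 0 :> R.
Proof.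
rewrite /multinomial mulf_neq0 ?factr_neq0// invr_neq0//.
by apply/prodf_neq0 => l _; exact: factr_neq0.
Qed.

Lemma bernsteinM (k d e : nat) (t u : k.-tuple nat) (s : 'rV[R]_k) :
  bernstein d t s * bernstein e u s =
  multinomial d t * multinomial e u / multinomial (d + e) (addmi t u)
  * bernstein (d + e) (addmi t u) s.
Proof.
rewrite /bernstein [RHS]mulrA divfK ?multinomial_neq0// mulrACA; congr (_ * _).
by rewrite -big_split; apply: eq_bigr => l _; rewrite tnth_mktuple exprD.
Qed.

(** Coefficients are functions of the multi-index itself, not of its rank in
    the enumeration, so that sums of multi-indices need no reindexing. *)
Definition bernstein_span (k d : nat) (f : 'rV[R]_k -> R) : Prop :=
  exists w : k.-tuple nat -> R,
    forall s, f s = \sum_(t <- mindices k d) w t * bernstein d t s.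

Lemma eq_bernstein_span (k d : nat) (f g : 'rV[R]_k -> R) :
  f =1 g -> bernstein_span d f -> bernstein_span d g.
Proof. by move=> fg [w fw]; exists w => s; rewrite -fg. Qed.

Lemma bernstein_span_bernstein (k d : nat) (t : k.-tuple nat) :
  t \in mindices k d -> bernstein_span d (bernstein d t).
Proof.
move=> td; exists (fun u => (u == t)%:R) => s.
rewrite (bigD1_seq t)//= ?mindices_uniq// eqxx mul1r big1 ?addr0// => u.
by move/negPf=> ->; rewrite mul0r.
Qed.

Lemma bernstein_spanZ (k d : nat) (a : R) (f : 'rV[R]_k -> R) :
  bernstein_span d f -> bernstein_span d (fun s => a * f s).
Proof.
case=> w fw; exists (fun t => a * w t) => s.
by rewrite fw mulr_sumr; apply: eq_bigr => t _; rewrite mulrA.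
Qed.

Lemma bernstein_span_sum (I : eqType) (r : seq I) (k d : nat)
    (F : I -> 'rV[R]_k -> R) :
  (forall i, i \in r -> bernstein_span d (F i)) ->
  bernstein_span d (fun s => \sum_(i <- r) F i s).
Proof.
elim: r => [_|i r IH Fr].
  by exists (fun=> 0) => s; rewrite big_nil big1// => t _; rewrite mul0r.
have [|w Fw] := IH; first by move=> j jr; apply: Fr; rewrite inE jr orbT.
have [u Fu] := Fr i (mem_head i r).
exists (fun t => u t + w t) => s; rewrite big_cons Fw Fu -big_split/=.
by apply: eq_bigr => t _; rewrite mulrDl.
Qed.

Lemma bernstein_spanM (k d e : nat) (f g : 'rV[R]_k -> R) :
  bernstein_span d f -> bernstein_span e g ->
  bernstein_span (d + e) (fun s => f s * g s).
Proof.
case=> v fv [w gw].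
apply: (@eq_bernstein_span _ _ (fun s => \sum_(t <- mindices k d)
  \sum_(u <- mindices k e) v t * w u * (bernstein d t s * bernstein e u s))).
  move=> s; rewrite fv gw mulr_suml; apply: eq_bigr => t _.
  by rewrite mulr_sumr; apply: eq_bigr => u _; rewrite mulrACA.
apply: bernstein_span_sum => t td; apply: bernstein_span_sum => u ue.
apply: bernstein_spanZ.
apply: eq_bernstein_span (fun s => esym (bernsteinM d e t u s)) _.
exact/bernstein_spanZ/bernstein_span_bernstein/mem_addmi.
Qed.

Lemma bernstein_span1 (k : nat) : bernstein_span 0 (fun _ : 'rV[R]_k => 1).
Proof.
pose t := [tuple 0%N | _ < k].
have b1 (s : 'rV[R]_k) : bernstein 0 t s = 1.
  rewrite /bernstein /multinomial !big1 ?divr1 ?mulr1// => l _;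
  by rewrite tnth_mktuple.
apply: eq_bernstein_span b1 _; apply: bernstein_span_bernstein.
by rewrite mem_mindices big1// => l _; rewrite tnth_mktuple.
Qed.

Lemma bernstein_spanX (k d n : nat) (f : 'rV[R]_k -> R) :
  bernstein_span d f -> bernstein_span (n * d) (fun s => f s ^+ n).
Proof.
move=> fd; elim: n => [|n IH]; first exact: bernstein_span1.
apply: eq_bernstein_span (fun s => esym (exprS (f s) n)) _.
by rewrite mulSn; exact: bernstein_spanM.
Qed.

Lemma bernstein_span_prod (I : Type) (r : seq I) (k : nat) (d : I -> nat)
    (F : I -> 'rV[R]_k -> R) :
  (forall i, bernstein_span (d i) (F i)) ->
  bernstein_span (\sum_(i <- r) d i) (fun s => \prod_(i <- r) F i s).
Proof.
move=> Fd; elim: r => [|i r IH].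
  rewrite big_nil; apply: eq_bernstein_span (bernstein_span1 k) => s.
  by rewrite big_nil.
rewrite big_cons; apply: eq_bernstein_span (bernstein_spanM (Fd i) IH) => s.
by rewrite big_cons.
Qed.

(** B^m_t(p) is a scalar times the product of the p_i^t_i, of degree
    n * t_0 + n * t_1 + ... = m * n. *)
Lemma bernstein_span_comp (k l m n : nat) (t : l.-tuple nat)
    (p : 'rV[R]_k -> 'rV[R]_l) :
  t \in mindices l m -> (forall i, bernstein_span n (fun s => p s 0 i)) ->
  bernstein_span (m * n) (fun s => bernstein m t (p s)).
Proof.
rewrite mem_mindices => /eqP <- pn; rewrite big_distrl/=.
apply: bernstein_spanZ; apply: bernstein_span_prod => i.
exact: bernstein_spanX.
Qed.

(** The integers 1, ..., size P are more roots than a nonzero P can have. *)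
Lemma poly_root_pos_eq0 (P : {poly R}) :
  (forall x : R, 0 < x -> P.[x] = 0) -> P = 0.
Proof.
move=> P0; pose rs : seq R := [seq i.+1%:R | i <- iota 0 (size P)].
apply: (@roots_geq_poly_eq0 _ _ rs).
- by apply/allP => _ /mapP[i _ ->]; rewrite /root P0// ltr0n.
- by rewrite map_inj_uniq ?iota_uniq// => i j /eqP; rewrite eqr_nat => /eqP[].
- by rewrite size_map size_iota.
Qed.

(** Induction on the number of variables. With the last k variables fixed, the
    sum is a polynomial in the first one that vanishes on the positive reals, so
    each of its coefficients vanishes; these are sums of the same kind in k
    variables. *)
Lemma monomials_free (k d : nat) (w : k.-tuple nat -> R) :
  (forall s : 'rV[R]_k, (forall l, 0 < s 0 l) ->
     \sum_(t <- mindices k d) w t * \prod_(l < k) s 0 l ^+ tnth t l = 0) ->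
  forall t, t \in mindices k d -> w t = 0.
Proof.
elim: k d w => [|k IH] d w ws t.
  rewrite mem_mindices big_ord0 => /eqP d0; have := ws 0.
  rewrite -d0 big_seq1 big_ord0 mulr1 (tuple0 t); apply.
  by case.
rewrite mindicesS => /flatten_mapP[i idr /mapP[u ud ->]].
apply: (IH (d - i)%N (fun u => w (cons_tuple i u))) ud => s s_gt0.
(* E j is the coefficient of x^j once the other variables are fixed to s. *)
pose E j := \sum_(v <- mindices k (d - j)) w (cons_tuple j v) *
                \prod_(l < k) s 0 l ^+ tnth v l.
suff P0 : \poly_(j < d.+1) E j = 0.
  have := coef_poly d.+1 E i; rewrite P0 coef0.
  by move: idr; rewrite mem_iota add0n => /andP[_ ->].
apply: poly_root_pos_eq0 => x x_gt0.
rewrite horner_poly.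
pose r : 'rV[R]_k.+1 := \row_l (if unlift ord0 l is Some l' then s 0 l' else x).
rewrite -[RHS](ws r); last by move=> l; rewrite mxE; case: unliftP.
rewrite mindicesS big_flatten big_map -/(index_iota 0 d.+1) big_mkord.
apply: eq_bigr => j _; rewrite big_map mulr_suml; apply: eq_bigr => v _.
rewrite big_ord_recl tnth0 mxE unlift_none -mulrA; congr (_ * _).
rewrite mulrC; congr (_ * _); apply: eq_bigr => l _.
by rewrite tnthS mxE liftK.
Qed.

(** A positive point s, divided by the sum of its coordinates, lies in the
    triangle, and this rescaling multiplies every Bernstein polynomial of degree
    N by the same power of that sum, so that vanishing on the triangle implies
    vanishing at s. *)
Lemma bernstein_free (N : nat) (v : 'I_('C(N + 2, 2)) -> R) :
  (forall s, triangle s -> \sum_j v j * bernstein N (mindex 2 N j) s = 0) ->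
  forall j, v j = 0.
Proof.
move=> v0 j.
(* The multinomial coefficient turns Bernstein coefficients into those of the
   monomials. *)
pose w (t : 3.-tuple nat) : R :=
  (\sum_(i | mindex 2 N i == t) v i) * multinomial N t.
have wE i : w (mindex 2 N i) = v i * multinomial N (mindex 2 N i).
  by rewrite /w sum_mindex_eq.
apply/eqP; rewrite -(mulIr_eq0 _ (mulIf (multinomial_neq0 N (mindex 2 N j)))).
rewrite -wE; apply/eqP.
apply: (@monomials_free 3 N); last exact: mem_mindex.
move=> s s_gt0.
pose c := \sum_l s 0 l.
have c_gt0 : 0 < c.
  rewrite /c big_ord_recl ltr_pwDl//.
  by apply: sumr_ge0 => l _; exact: ltW.
have /v0 : triangle (c^-1 *: s).
  split; first by move=> l; rewrite mxE mulr_ge0 ?invr_ge0 ?ltW.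
  under eq_bigr do rewrite mxE.
  by rewrite -mulr_sumr mulVf// gt_eqF.
move/(congr1 ( *%R (c ^+ N))); rewrite mulr0 => sum0; rewrite -[RHS]sum0.
rewrite -(sum_mindex N (fun t => w t * \prod_(l < 3) s 0 l ^+ tnth t l)).
rewrite mulr_sumr; apply: eq_bigr => i _.
rewrite wE /bernstein -!mulrA [RHS]mulrCA; congr (_ * _).
have := mem_mindex i; rewrite mem_mindices => /eqP Ni.
rewrite -[in c ^+ N]Ni [RHS]mulrCA; congr (_ * _).
rewrite [RHS]mulrCA; congr (_ * _).
rewrite -prodrXr -big_split; apply: eq_bigr => l _ /=.
by rewrite mxE -exprMn mulVKf// gt_eqF.
Qed.

End BernsteinAlgebra.

(** * Integrals of Bernstein polynomials over the triangle *)

Section TriangleIntegral.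
Context {R : realType}.
Local Notation mu := (@lebesgue_measure R).
Local Notation T :=
  [set z : R * R | [/\ 0 <= z.1, 0 <= z.2 & z.1 + z.2 <= 1]]%classic.

Definition triangle_integrable (f : 'rV[R]_3 -> R) : Prop :=
  (mu \x mu)%E.-integrable T (fun z => (f (triangle_point z.1 z.2))%:E).

Lemma triangle_pointP (z : R * R) : T z -> triangle (triangle_point z.1 z.2).
Proof.
case=> z1 z2 z12; split; last first.
  by rewrite !big_ord_recl big_ord0 !mxE/=; ring.
by move=> l; rewrite mxE; case: l => [[|[|[|]]]]//= _; lra.
Qed.

Lemma eq_triangle_integral (f g : 'rV[R]_3 -> R) :
  (forall s, triangle s -> f s = g s) ->
  triangle_integral f = triangle_integral g.
Proof.
move=> fg; apply: eq_Rintegral => z /set_mem Tz.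
exact/fg/triangle_pointP.
Qed.

Lemma triangle_integrableZ (a : R) (f : 'rV[R]_3 -> R) :
  triangle_integrable f -> triangle_integrable (fun s => a * f s).
Proof.
by move=> fi; exact: (integrableZl measurable_parameter_triangle a fi).
Qed.

Lemma triangle_integralZ (a : R) (f : 'rV[R]_3 -> R) :
  triangle_integrable f ->
  triangle_integral (fun s => a * f s) = a * triangle_integral f.
Proof.
move=> fi; rewrite /triangle_integral RintegralZl//.
exact: measurable_parameter_triangle.
Qed.

Lemma triangle_integral_sum (I : Type) (r : seq I) (F : I -> 'rV[R]_3 -> R) :
  (forall i, triangle_integrable (F i)) ->
  triangle_integral (fun s => \sum_(i <- r) F i s) =
  \sum_(i <- r) triangle_integral (F i).
Proof.
move=> Fi; have mT := @measurable_parameter_triangle R.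
rewrite /triangle_integral /Rintegral.
under eq_integral do rewrite -sumEFin.
rewrite integral_sum// -sum_fine// => i _.
exact: integrable_fin_num (Fi i).
Qed.

Lemma bernstein_triangle_point (d : nat) (t : 3.-tuple nat) (z : R * R) :
  bernstein d t (triangle_point z.1 z.2) = multinomial d t *
  dirichlet_fun (nth 0%N t 0) (nth 0%N t 1) (nth 0%N t 2) z.
Proof.
rewrite /bernstein !big_ord_recl big_ord0 !mxE !(tnth_nth 0%N) mulr1.
by rewrite /dirichlet_fun -!mulrA.
Qed.

(** The multinomial coefficient is exactly what makes Dirichlet's integral
    independent of the multi-index t. *)
Lemma integral_bernstein (d : nat) (t : 3.-tuple nat) :
  t \in mindices 3 d ->
  (\int[(mu \x mu)%E]_(z in T) (bernstein d t (triangle_point z.1 z.2))%:E =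
   (1 / ((d + 1)%:R * (d + 2)%:R))%:E)%E.
Proof.
rewrite mem_mindices => /eqP td.
under eq_integral do rewrite bernstein_triangle_point EFinM.
rewrite ge0_integralZl_EFin; last 4 first.
- exact: measurable_parameter_triangle.
- move=> z [z1 z2 z12]; rewrite lee_fin !mulr_ge0// exprn_ge0//; lra.
- apply/measurable_EFinP.
  exact: measurable_funS (measurable_dirichlet_fun _ _ _).
- by rewrite divr_ge0//; apply: prodr_ge0.
rewrite integral_dirichlet -EFinM; congr EFin.
move: td; rewrite /multinomial !big_ord_recl !big_ord0 mulr1 addn0.
rewrite !(tnth_nth 0%N)/= !addnA => ->; rewrite !factS.
have nz (n : nat) : n.+1%:R != 0 :> R by rewrite pnatr_eq0.
rewrite -[bump 0 0]/1%N -[bump 0 1]/2%N addn1 addn2 !natrM.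
move: (@factr_neq0 R (nth 0%N t 0)) (@factr_neq0 R (nth 0%N t 1)).
move: (@factr_neq0 R (nth 0%N t 2)) (@factr_neq0 R d) (nz d) (nz d.+1).
move: ((nth 0%N t 0)`!%:R : R) ((nth 0%N t 1)`!%:R : R) => u v.
move: ((nth 0%N t 2)`!%:R : R) (d`!%:R : R) => w x.
move: (d.+1%:R : R) (d.+2%:R : R) => y z wn xn yn zn un vn.
by field; rewrite zn yn xn wn un vn.
Qed.

Lemma triangle_integral_bernstein (d : nat) (t : 3.-tuple nat) :
  t \in mindices 3 d ->
  triangle_integral (bernstein d t) = 1 / ((d + 1)%:R * (d + 2)%:R) :> R.
Proof.
by move=> td; rewrite /triangle_integral /Rintegral integral_bernstein.
Qed.

(** A Bernstein polynomial is nonnegative on the triangle, so its integral,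
    already known to be finite, is also that of its absolute value. *)
Lemma bernstein_integrable (d : nat) (t : 3.-tuple nat) :
  t \in mindices 3 d -> triangle_integrable (bernstein d t).
Proof.
move=> td; apply/integrableP; split.
  apply/measurable_EFinP.
  apply: (eq_measurable_fun (fun z => multinomial d t *
      dirichlet_fun (nth 0%N t 0) (nth 0%N t 1) (nth 0%N t 2) z)).
    by move=> z _; rewrite bernstein_triangle_point.
  apply: measurable_funM => //.
  exact: measurable_funS (measurable_dirichlet_fun _ _ _).
under eq_integral => z /set_mem Tz.
  rewrite gee0_abs; last first.
    rewrite lee_fin /bernstein mulr_ge0//.
      by rewrite divr_ge0//; apply: prodr_ge0.
    by apply: prodr_ge0 => l _; rewrite exprn_ge0// (triangle_pointP Tz).1.
  over.
by rewrite integral_bernstein// ltry.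
Qed.

Lemma triangle_integrable_bernsteinM (d e : nat) (t u : 3.-tuple nat) :
  t \in mindices 3 d -> u \in mindices 3 e ->
  triangle_integrable (fun s => bernstein d t s * bernstein e u s).
Proof.
move=> td ue; rewrite (funext (bernsteinM d e t u)).
exact/triangle_integrableZ/bernstein_integrable/mem_addmi.
Qed.

Lemma bernstein_gram_mxE (N : nat) (i j : 'I_('C(N + 2, 2))) :
  bernstein_gram_mx N i j =
  multinomial N (mindex 2 N i) * multinomial N (mindex 2 N j)
  / multinomial (N + N) (addmi (mindex 2 N i) (mindex 2 N j))
  * (1 / ((N + N + 1)%:R * (N + N + 2)%:R)) :> R.
Proof.
have ij := mem_addmi (mem_mindex i) (mem_mindex j).
rewrite mxE (funext (bernsteinM N N _ _)) triangle_integralZ; last first.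
  exact: bernstein_integrable.
by rewrite triangle_integral_bernstein.
Qed.

(** Bilinearity of the integral of a product; integrability of the finitely
    many products of basis elements makes it legitimate. *)
Lemma triangle_integral_gram (N : nat) (v w : 'I_('C(N + 2, 2)) -> R) :
  triangle_integral (fun s =>
    (\sum_j v j * bernstein N (mindex 2 N j) s) *
    (\sum_k w k * bernstein N (mindex 2 N k) s)) =
  \sum_j \sum_k v j * w k * bernstein_gram_mx N j k.
Proof.
pose B j k s : R := bernstein N (mindex 2 N j) s * bernstein N (mindex 2 N k) s.
have Bi j k : triangle_integrable (B j k).
  by apply: triangle_integrable_bernsteinM; exact: mem_mindex.
rewrite pair_bigA.
transitivity (triangle_integral (fun s =>
    \sum_(jk : 'I_('C(N + 2, 2)) * 'I_('C(N + 2, 2)))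
       v jk.1 * w jk.2 * B jk.1 jk.2 s)).
  apply: eq_triangle_integral => s _.
  rewrite -(pair_bigA _ (fun j k => v j * w k * B j k s))/= mulr_suml.
  apply: eq_bigr => j _; rewrite mulr_sumr.
  by apply: eq_bigr => k _; rewrite /B mulrACA.
rewrite triangle_integral_sum; last by move=> jk; exact: triangle_integrableZ.
by apply: eq_bigr => jk _; rewrite triangle_integralZ// mxE.
Qed.

End TriangleIntegral.

(** * The factorization of the matrix of weak approximate implicitization *)

Theorem proposition2 (R : realType) (m n : nat) (m_ge1 : (1 <= m)%N)
    (n_ge1 : (1 <= n)%N)
    (* the tetrahedron Lambda *)
    (a : 'I_4 -> 'rV[R]_3) (a_nondeg : nondegenerate_simplex a)
    (* the control points and their barycentric coordinates *)
    (x : 'I_('C(n + 2, 2)) -> 'rV[R]_3) (c : 'I_('C(n + 2, 2)) -> 'rV[R]_4)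
    (c_bary : forall i, barycentric_coords a (x i) (c i)) :
  let p := bezier_triangle c in
  let N := (m * n)%N in
  let M := weak_implicit_mx m p in
  let A : 'M[R]_('C(N + 2, 2)) := bernstein_gram_mx N in
  [/\ forall b : 'cV[R]_('C(m + 3, 3)),
        triangle_integral (fun s => bernstein_form b (p s) ^+ 2) =
        (b^T *m M *m b) 0 0,
      exists D : 'M[R]_('C(N + 2, 2), 'C(m + 3, 3)),
        [/\ bernstein_expansion p D,
            forall D', bernstein_expansion p D' -> D' = D &
            M = D^T *m A *m D],
      A^T = A &
      forall i j : 'I_('C(N + 2, 2)),
        A i j = multinomial N (mindex 2 N i) * multinomial N (mindex 2 N j)
                / multinomial (2 * N) (addmi (mindex 2 N i) (mindex 2 N j))
                * (1 / ((2 * N + 1)%:R * (2 * N + 2)%:R))].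
Proof.
move=> p N M A.
(* Existence of the expansion: each coordinate of p is a Bernstein form of
   degree n whose coefficients are those coordinates of the control points. *)
have [D DE] : exists D : 'M[R]_('C(N + 2, 2), 'C(m + 3, 3)),
    bernstein_expansion p D.
  have pn l : bernstein_span n (fun s => p s 0 l).
    exists (fun t => \sum_(i | mindex 2 n i == t) c i 0 l) => s.
    rewrite -sum_mindex summxE; apply: eq_bigr => i _.
    by rewrite mxE mulrC sum_mindex_eq.
  have /choice[w wE] i : exists w, forall s, bernstein m (mindex 3 m i) (p s) =
      \sum_(t <- mindices 3 N) w t * bernstein N t s.
    exact: bernstein_span_comp (mem_mindex i) pn.
  exists (\matrix_(j, i) w i (mindex 2 N j)) => i s _.
  by rewrite wE -sum_mindex; apply: eq_bigr => j _; rewrite mxE.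
have ME : M = D^T *m A *m D.
  apply/matrixP => i j; rewrite [LHS]mxE.
  under eq_triangle_integral => s ts do rewrite !DE//.
  rewrite triangle_integral_gram exchange_big mxE; apply: eq_bigr => k _.
  rewrite mxE mulr_suml; apply: eq_bigr => l _.
  by rewrite !mxE mulrAC.
split.
- move=> b.
  (* q(p(s)) is the Bernstein form with coefficient vector D b. *)
  transitivity (triangle_integral (fun s =>
    (\sum_j (D *m b) j 0 * bernstein N (mindex 2 N j) s) *
    (\sum_k (D *m b) k 0 * bernstein N (mindex 2 N k) s))).
    apply: eq_triangle_integral => s ts; rewrite -expr2; congr (_ ^+ 2).
    rewrite /bernstein_form; under eq_bigr do rewrite DE// mulr_sumr.
    rewrite exchange_big; apply: eq_bigr => j _; rewrite mxE mulr_suml.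
    by apply: eq_bigr => i _; rewrite mulrCA mulrA.
  rewrite triangle_integral_gram ME !mulmxA -trmx_mul -mulmxA.
  rewrite exchange_big mxE; apply: eq_bigr => k _.
  rewrite [in RHS]mxE mulr_suml; apply: eq_bigr => l _.
  by rewrite [(D *m b)^T _ _]mxE mulrAC.
- exists D; split => // D' D'E; apply/matrixP => j i.
  apply/eqP; rewrite -subr_eq0; apply/eqP; move: j.
  apply: (@bernstein_free _ N) => s ts.
  under eq_bigr do rewrite mulrBl.
  by rewrite sumrB -D'E// -DE// subrr.
- apply/matrixP => i j; rewrite !mxE; apply: eq_triangle_integral => s _.
  exact: mulrC.
- by move=> i j; rewrite mul2n -addnn; exact: bernstein_gram_mxE.
Qed.
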